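(* For all positive integers $d,m,n_1,\ldots,n_d$, $$S_m(n_1,\ldots,n_d)\le Z_{\max}\big(m(n_1+\ldots+n_d),\ n_1\cdots n_d,\ d\big).$$
   Context: A tensor is an array $T\in\mathbb R^{n_1\times\cdots\times n_d}$ with entries $T_{i_1,\ldots,i_d}$, $1\le i_j\le n_j$. A nonzero tensor has rank $1$ if $T_{i_1,\ldots,i_d}=u^1_{i_1}u^2_{i_2}\cdots u^d_{i_d}$ for some vectors $u^j\in\mathbb R^{n_j}$; a tensor has rank at most $m$ if it is a sum of $m$ rank-one tensors (or fewer; the zero tensor has rank $0$). A signum tensor is a tensor with all entries in $\{-1,1\}$. The signum rank $\operatorname{rank}_\pm S$ of a signum tensor $S$ is the minimal rank of a tensor $T\in\mathbb R^{n_1\times\cdots\times n_d}$ such that $\operatorname{sign}T_{i_1,\ldots,i_d}=S_{i_1,\ldots,i_d}$ for all indices; the convention is $\operatorname{sign}0=0$, so $T$ must have nonzero entries. $S_m(n_1,\ldots,n_d)$ is the number of signum tensors $S\in\{-1,1\}^{n_1\times\cdots\times n_d}$ with $\operatorname{rank}_\pm S\le m$. For real polynomials $p_1,\ldots,p_l$ on $\mathbb R^k$, $Z(p_1,\ldots,p_l)$ is the cardinality of the set of those vectors $(\operatorname{sign}p_1(x),\ldots,\operatorname{sign}p_l(x))$, $x\in\mathbb R^k$, all of whose coordinates are nonzero. $Z_{\max}(k,l,s)$ is the maximal possible value of $Z(p_1,\ldots,p_l)$ over all $l$-tuples of polynomials on $\mathbb R^k$ of degree at most $s$. *)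

(* Defs.v *)
From HB Require Import structures.
From mathcomp Require Import all_boot all_order all_algebra.
From mathcomp Require Import finmap.
From mathcomp Require Import boolp classical_sets cardinality reals.
From mathcomp Require Import mpoly.

Set Implicit Arguments.
Unset Strict Implicit.
Unset Printing Implicit Defensive.

Import Order.TTheory GRing.Theory Num.Theory.
Local Open Scope classical_set_scope.
Local Open Scope ring_scope.

Definition tindex (d : nat) (n : 'I_d -> nat) := {dffun forall j : 'I_d, 'I_(n j)}.

Notation tensor R n := {ffun tindex n -> R}.

Definition outer (R : realType) (d : nat) (n : 'I_d -> nat)
    (u : forall j : 'I_d, 'rV[R]_(n j)) : tensor R n :=
  [ffun i : tindex n => \prod_(j < d) u j 0 (i j)].

Definition rank_one (R : realType) (d : nat) (n : 'I_d -> nat)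
    (T : tensor R n) : Prop :=
  T != 0 /\ exists u : forall j : 'I_d, 'rV[R]_(n j), T = outer u.

Definition rank_at_most (R : realType) (d : nat) (n : 'I_d -> nat)
    (T : tensor R n) (m : nat) : Prop :=
  exists r : nat, (r <= m)%N /\
  exists F : 'I_r -> tensor R n,
    (forall k, rank_one (F k)) /\ T = \sum_(k < r) F k.

(* On a nonempty set of naturals [infimum 0%N] is the minimum, so this is the
   rank when [0 < d] (see [tensor_rankP]). For [d = 0] a negative scalar is not
   a sum of rank-one tensors, and the default value [0] is returned. *)
Definition tensor_rank (R : realType) (d : nat) (n : 'I_d -> nat)
    (T : tensor R n) : nat :=
  infimum 0%N [set m | rank_at_most T m].

Definition signum_tensor (R : realType) (d : nat) (n : 'I_d -> nat)
    (S : tensor R n) : Prop :=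
  forall i, S i = 1 \/ S i = -1.

(* A minimum when [S] is a signum tensor (see [signum_rankP]). *)
Definition signum_rank (R : realType) (d : nat) (n : 'I_d -> nat)
    (S : tensor R n) : nat :=
  infimum 0%N
    [set tensor_rank T | T in [set T : tensor R n | forall i, Num.sg (T i) = S i]].

(* [fset_set A] is empty when [A] is infinite; the sets counted below are
   finite (see [finite_signum_tensors] and [finite_sign_vectors]). *)
Definition num_signum_tensors (R : realType) (d : nat) (n : 'I_d -> nat)
    (m : nat) : nat :=
  #|` fset_set [set S : tensor R n | signum_tensor S /\ (signum_rank S <= m)%N] |.

Definition sign_vector (R : realType) (k l : nat) (p : 'I_l -> {mpoly R[k]})
    (x : 'I_k -> R) : {ffun 'I_l -> R} :=
  [ffun i => Num.sg (p i).@[x]].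

Definition Zcount (R : realType) (k l : nat) (p : 'I_l -> {mpoly R[k]}) : nat :=
  #|` fset_set [set v : {ffun 'I_l -> R} |
                (exists x : 'I_k -> R, v = sign_vector p x) /\
                (forall i, v i != 0)] |.

(* [msize] is one more than the total degree, and [0] for the zero
   polynomial. [supremum 0%N] is a maximum here (see [Zmax_max]). *)
Definition Zmax (R : realType) (k l s : nat) : nat :=
  supremum 0%N
    [set Zcount p | p in [set p : 'I_l -> {mpoly R[k]} |
                     forall i, (msize (p i) <= s.+1)%N]].

Lemma nat_infimumP (A : set nat) :
  A !=set0 -> A (infimum 0%N A) /\ lbound A (infimum 0%N A).
Proof.
move=> [a Aa].
have exA : exists b, `[< A b >] by exists a; apply/asboolP.
case: (ex_minnP exA) => b /asboolP Ab bmin.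
have lb : lbound A b by move=> c Ac; rewrite leEnat; apply/bmin/asboolP.
have inf_b : infimums A b by split=> // c; apply.
rewrite /infimum ifF; last by apply/negbTE/set0P; exists a.
by rewrite (xget_subset1 0%N inf_b (@is_subset1_infimums _ _ A)).
Qed.

Lemma nat_supremumP (A : set nat) (N : nat) :
  A !=set0 -> ubound A N -> A (supremum 0%N A) /\ ubound A (supremum 0%N A).
Proof.
move=> [a Aa] ubN.
have exA : exists b, `[< A b >] by exists a; apply/asboolP.
have leN b : `[< A b >] -> (b <= N)%N by move=> /asboolP /ubN; rewrite leEnat.
case: (ex_maxnP exA leN) => b /asboolP Ab bmax.
have ub : ubound A b by move=> c Ac; rewrite leEnat; apply/bmax/asboolP.
have sup_b : supremums A b by split=> // c; apply.
rewrite /supremum ifF; last by apply/negbTE/set0P; exists a.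
by rewrite (xget_subset1 0%N sup_b (@is_subset1_supremums _ _ A)).
Qed.

Lemma rank_at_most_add (R : realType) (d : nat) (n : 'I_d -> nat)
    (T1 T2 : tensor R n) (m1 m2 : nat) :
  rank_at_most T1 m1 -> rank_at_most T2 m2 -> rank_at_most (T1 + T2) (m1 + m2).
Proof.
move=> [r1 [le1 [F1 [F1P ->]]]] [r2 [le2 [F2 [F2P ->]]]].
exists (r1 + r2)%N; split; first exact: leq_add.
exists (fun k : 'I_(r1 + r2) => match split k with inl a => F1 a | inr b => F2 b end).
split; first by move=> k; case: splitP => j _.
rewrite big_split_ord; congr (_ + _); apply: eq_bigr => k _ /=.
  by rewrite -[lshift _ _]/(unsplit (inl k)) unsplitK.
by rewrite -[rshift _ _]/(unsplit (inr k)) unsplitK.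
Qed.

Lemma rank_at_most_ex (R : realType) (d : nat) (n : 'I_d -> nat)
    (T : tensor R n) :
  (0 < d)%N -> exists m, rank_at_most T m.
Proof.
case: d n T => // d n T _.
have rk0 : rank_at_most (0 : tensor R n) 0.
  by exists 0%N; split=> //; exists (fun=> 0); split; [case | rewrite big_ord0].
have -> : T = \sum_i [ffun i' => if i' == i then T i else 0].
  apply/ffunP => i; rewrite sum_ffunE (bigD1 i) //= ffunE eqxx big1 ?addr0 //.
  by move=> j ji; rewrite ffunE eq_sym (negbTE ji).
apply: (big_ind (fun U : tensor R n => exists m, rank_at_most U m)).
- by exists 0%N.
- by move=> U V [a ?] [b ?]; exists (a + b)%N; apply: rank_at_most_add.
move=> i _; set E := [ffun _ => _].
have [-> | E0] := eqVneq E 0; first by exists 0%N.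
exists 1%N; exists 1%N; split=> //; exists (fun=> E); split; last by rewrite big_ord1.
move=> _; split=> //.
exists (fun j => \row_b (if b == i j then if j == ord0 then T i else 1 else 0)).
apply/ffunP => i'; rewrite !ffunE.
have [-> | ] := eqVneq i' i.
  rewrite big_ord_recl mxE eqxx eqxx big1 ?mulr1 // => j _.
  by rewrite mxE eqxx.
move=> ii'; have [j ij] : exists j, i' j != i j.
  apply/existsP; apply: contraR ii' => /existsPn h; apply/eqP/ffunP => j.
  by apply/eqP; move: (h j); rewrite negbK.
by rewrite (bigD1 j) //= mxE (negbTE ij) mul0r.
Qed.

Lemma tensor_rankP (R : realType) (d : nat) (n : 'I_d -> nat)
    (T : tensor R n) (m : nat) :
  (0 < d)%N -> (tensor_rank T <= m)%N <-> rank_at_most T m.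
Proof.
move=> d0; have [] := @nat_infimumP [set m | rank_at_most T m].
  exact: rank_at_most_ex.
rewrite -/(tensor_rank T) => -[r [ler FP]] lb; split; last by move=> /lb.
by move=> le; exists r; split=> //; exact: leq_trans le.
Qed.

Lemma signum_rankP (R : realType) (d : nat) (n : 'I_d -> nat)
    (S : tensor R n) (m : nat) : signum_tensor S ->
  (signum_rank S <= m)%N <->
  exists T : tensor R n,
    (forall i, Num.sg (T i) = S i) /\ (tensor_rank T <= m)%N.
Proof.
move=> Ssg; rewrite /signum_rank; set A := (X in infimum _ X).
have [] := @nat_infimumP A.
  exists (tensor_rank S); exists S => // i.
  by case: (Ssg i) => ->; rewrite ?sgrN1 ?sgr1.
move=> [T TS TA] lb; split; first by rewrite -TA => le; exists T.
move=> [U [US leU]]; have /lb : A (tensor_rank U) by exists U.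
by rewrite leEnat => /leq_trans; apply.
Qed.

Lemma signs_sub_range (R : realType) (I : finType) (A : set {ffun I -> R}) :
  (forall v, A v -> forall i, v i = 1 \/ v i = -1) ->
  A `<=` range (fun b : {ffun I -> bool} => [ffun i => (-1) ^+ b i : R]).
Proof.
move=> sgA v Av; exists [ffun i => v i == -1] => //.
apply/ffunP => i; rewrite !ffunE; case: (sgA v Av i) => ->; rewrite ?eqxx //.
by rewrite -subr_eq0 opprK -[1 + 1]/(2%:R) pnatr_eq0.
Qed.

Lemma finite_signs (R : realType) (I : finType) (A : set {ffun I -> R}) :
  (forall v, A v -> forall i, v i = 1 \/ v i = -1) -> finite_set A.
Proof.
move=> /signs_sub_range /sub_finite_set; apply.
exact/finite_image/finite_finset.
Qed.

Lemma finite_signum_tensors (R : realType) (d : nat) (n : 'I_d -> nat) (m : nat) :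
  finite_set [set S : tensor R n | signum_tensor S /\ (signum_rank S <= m)%N].
Proof. by apply: finite_signs => S []. Qed.

Lemma sign_vectors_signs (R : realType) (k l : nat) (p : 'I_l -> {mpoly R[k]})
    (v : {ffun 'I_l -> R}) :
  (exists x, v = sign_vector p x) /\ (forall i, v i != 0) ->
  forall i, v i = 1 \/ v i = -1.
Proof.
move=> [[x ->] v0] i; move: (v0 i); rewrite ffunE.
by case: sgrP => _; rewrite ?eqxx // => _; [left | right].
Qed.

Lemma finite_sign_vectors (R : realType) (k l : nat) (p : 'I_l -> {mpoly R[k]}) :
  finite_set [set v : {ffun 'I_l -> R} |
    (exists x : 'I_k -> R, v = sign_vector p x) /\ (forall i, v i != 0)].
Proof. by apply: finite_signs => v /sign_vectors_signs. Qed.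

Lemma Zcount_le (R : realType) (k l : nat) (p : 'I_l -> {mpoly R[k]}) :
  (Zcount p <= 2 ^ l)%N.
Proof.
pose g (b : {ffun 'I_l -> bool}) : {ffun 'I_l -> R} := [ffun i => (-1) ^+ b i].
have card_bool : #|{: {ffun 'I_l -> bool}}| = (2 ^ l)%N.
  by rewrite card_ffun card_bool card_ord.
rewrite -card_bool cardT -(size_map g).
apply: uniq_leq_size => [|v]; first exact: fset_uniq.
rewrite in_fset_set; last exact: finite_sign_vectors.
rewrite inE => vP.
have [b _ <-] := @signs_sub_range R _ _ (@sign_vectors_signs R k l p) v vP.
by apply: map_f; rewrite mem_enum.
Qed.

Lemma Zmax_max (R : realType) (k l s : nat) :
  (exists p : 'I_l -> {mpoly R[k]},
     (forall i, (msize (p i) <= s.+1)%N) /\ Zcount p = Zmax R k l s) /\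
  (forall p : 'I_l -> {mpoly R[k]},
     (forall i, (msize (p i) <= s.+1)%N) -> (Zcount p <= Zmax R k l s)%N).
Proof.
rewrite /Zmax; set A := (X in supremum _ X).
have [] := @nat_supremumP A (2 ^ l).
- by exists (Zcount (fun _ : 'I_l => 0 : {mpoly R[k]})); exists (fun=> 0) => // i; rewrite msize0.
- by move=> _ [p _ <-]; rewrite leEnat Zcount_le.
move=> [p pP Zpmax] ub; split; first by exists p.
by move=> q qP; rewrite -leEnat; apply: ub; exists q.
Qed.

(* Main.v *)
Require Import Defs.
From mathcomp Require Import all_boot all_order all_algebra.
From mathcomp Require Import finmap boolp classical_sets cardinality reals.
From mathcomp Require Import mpoly.

(** The entries of a sum of [m] outer products are polynomials in the
    coordinates of the vectors [u_k^j] ([k < m], [j < d]) that generate it. There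
    are [m * (n_1 + ... + n_d)] such coordinates, one polynomial for each of the
    [n_1 * ... * n_d] entries, and each polynomial is a sum of products of [d]
    variables, hence of degree at most [d] ([msize_entry_poly]).

    Every tensor of rank at most [m] is a value of this parametrization
    ([rank_at_most_outer_sum], [meval_entry_poly]). Hence a signum tensor of
    signum rank at most [m], read as a list of its entries, is a sign vector
    without zero coordinate of this family of polynomials. Since reading off the
    entries is injective, the number of these signum tensors is at most the
    number of such sign vectors of this one family, which is at most [Zmax]. *)

Set Implicit Arguments.
Unset Strict Implicit.
Unset Printing Implicit Defensive.

Import Order.TTheory GRing.Theory Num.Theory.
Local Open Scope classical_set_scope.
Local Open Scope ring_scope.

(** The names of the parameters: [(k, Tagged _ b)] with [b : 'I_(n j)] stands for
    the coordinate [b] of the [j]-th vector of the [k]-th outer product. *)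
Definition coord (d m : nat) (n : 'I_d -> nat) : finType :=
  ('I_m * {j : 'I_d & 'I_(n j)})%type.

Lemma card_coord (d m : nat) (n : 'I_d -> nat) :
  #|coord m n| = (m * \sum_(j < d) n j)%N.
Proof.
rewrite card_prod card_ord card_tagged sumnE big_map big_enum /=.
by congr (_ * _)%N; apply: eq_bigr => j _; rewrite card_ord.
Qed.

Lemma card_tindex (d : nat) (n : 'I_d -> nat) :
  #|{: tindex n}| = (\prod_(j < d) n j)%N.
Proof.
rewrite card_dep_ffun foldrE big_map big_enum /=.
by apply: eq_bigr => j _; rewrite card_ord.
Qed.

Definition coord_var (d m : nat) (n : 'I_d -> nat) (k : 'I_m) (i : tindex n)
    (j : 'I_d) : 'I_#|coord m n| :=
  enum_rank ((k, Tagged (fun j => 'I_(n j)) (i j)) : coord m n).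

Definition entry_poly (R : realType) (d m : nat) (n : 'I_d -> nat)
    (i : tindex n) : {mpoly R[#|coord m n|]} :=
  \sum_(k < m) \prod_(j < d) 'X_(coord_var k i j).

Lemma msize_entry_poly (R : realType) (d m : nat) (n : 'I_d -> nat)
    (i : tindex n) : (msize (entry_poly R m i) <= d.+1)%N.
Proof.
apply: (leq_trans (msize_sum _ _ _)); apply/bigmax_leqP => k _.
rewrite mprodXE msizeX mdeg_sum ltnS.
by under eq_bigr do rewrite mdeg1; rewrite sum_nat_const card_ord muln1.
Qed.

Definition coord_point (R : realType) (d m : nat) (n : 'I_d -> nat)
    (u : 'I_m -> forall j : 'I_d, 'rV[R]_(n j)) (c : 'I_#|coord m n|) : R :=
  let: (k, t) := enum_val c : coord m n in u k (tag t) 0 (tagged t).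

Lemma meval_entry_poly (R : realType) (d m : nat) (n : 'I_d -> nat)
    (u : 'I_m -> forall j : 'I_d, 'rV[R]_(n j)) (i : tindex n) :
  (entry_poly R m i).@[coord_point u] = (\sum_(k < m) outer (u k)) i.
Proof.
rewrite raddf_sum sum_ffunE; apply: eq_bigr => k _ /=.
rewrite rmorph_prod ffunE; apply: eq_bigr => j _ /=.
by rewrite mevalXU /coord_point enum_rankK.
Qed.

Lemma outer0 (R : realType) (d : nat) (n : 'I_d -> nat) :
  (0 < d)%N -> outer (fun j : 'I_d => 0 : 'rV[R]_(n j)) = 0.
Proof.
move=> d0; apply/ffunP => i; rewrite !ffunE (bigD1 (Ordinal d0)) //=.
by rewrite mxE mul0r.
Qed.

(** A sum of fewer than [m] outer products is padded with outer products of zero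
    vectors. These vanish only because [0 < d]: the empty product is [1]. *)
Lemma rank_at_most_outer_sum (R : realType) (d m : nat) (n : 'I_d -> nat)
    (T : tensor R n) : (0 < d)%N -> rank_at_most T m ->
  exists u : 'I_m -> forall j : 'I_d, 'rV[R]_(n j), T = \sum_(k < m) outer (u k).
Proof.
move=> d0 [r [lerm [F [FP ->]]]].
have [w Fw] := boolp.choice (fun k => proj2 (FP k)).
exists (fun k => if insub (val k) is Some k' then w k' else fun j => 0).
under eq_bigr do rewrite Fw.
pose f (a : nat) : tensor R n :=
  if insub a is Some k' then outer (w k') else 0.
transitivity (\sum_(k < r) f k).
  by apply: eq_bigr => k _; rewrite /f valK.
rewrite (big_ord_widen m f lerm) big_mkcond; apply: eq_bigr => k _ /=.
rewrite /f; case: insubP => [k' -> _ // | /negbTE ->].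
by rewrite outer0.
Qed.

(** Sign vectors are indexed by ordinals and tensors by multi-indices, so the
    comparison of the two goes through this injection. *)
Definition entries (R : realType) (d : nat) (n : 'I_d -> nat) (S : tensor R n) :
    {ffun 'I_#|{: tindex n}| -> R} :=
  [ffun l => S (enum_val l)].

Lemma entries_inj (R : realType) (d : nat) (n : 'I_d -> nat) :
  injective (@entries R d n).
Proof.
move=> S T /ffunP ST; apply/ffunP => i.
by move: (ST (enum_rank i)); rewrite !ffunE enum_rankK.
Qed.

Lemma signum_rank_sign_vector (R : realType) (d m : nat) (n : 'I_d -> nat)
    (S : tensor R n) :
  (0 < d)%N -> signum_tensor S -> (signum_rank S <= m)%N ->
  exists x, entries S = sign_vector (fun l => entry_poly R m (enum_val l)) x.
Proof.
move=> d0 Ssg /(signum_rankP _ Ssg) [T [TS /(tensor_rankP _ _ d0)]].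
move=> /(rank_at_most_outer_sum d0) [u Tu]; exists (coord_point u).
by apply/ffunP => l; rewrite !ffunE meval_entry_poly -Tu TS.
Qed.

Theorem mainTheorem6 (R : realType) (d m : nat) (n : 'I_d -> nat)
  (hd : (0 < d)%N) (hm : (0 < m)%N) (hn : forall j : 'I_d, (0 < n j)%N) :
  (num_signum_tensors R n m
     <= Zmax R (m * \sum_(j < d) n j) (\prod_(j < d) n j) d)%N.
Proof.
(* With both sizes written as cardinals, variables and polynomials are numbered
   by [enum_rank] and [enum_val] without any cast. *)
rewrite -card_coord -card_tindex.
pose p (l : 'I_#|{: tindex n}|) := entry_poly R m (enum_val l).
have [_ /(_ p) le_Zmax] := Zmax_max R #|coord m n| #|{: tindex n}| d.
apply: leq_trans (le_Zmax _) => [|l]; last exact: msize_entry_poly.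
rewrite /num_signum_tensors /Zcount -(size_map (@entries R d n)).
apply: uniq_leq_size.
  by rewrite map_inj_uniq ?fset_uniq //; exact: entries_inj.
move=> _ /mapP[S + ->].
rewrite in_fset_set; last exact: finite_signum_tensors.
rewrite in_fset_set; last exact: finite_sign_vectors.
rewrite !inE => -[Ssg rkS]; split; first exact: signum_rank_sign_vector.
by move=> l; rewrite ffunE; case: (Ssg (enum_val l)) => ->;
  rewrite ?oppr_eq0 oner_neq0.
Qed.
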